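(* Let $k \ge 1$ and $m \ge 1$ be integers. There exists a bijection between the set $B_{k,m}$ and the set $\{T_k\} \times H_{k,m}$.
   Context: $B_{k,m}$ is the set of partitions $\pi = (\pi_1, \pi_2, \ldots, \pi_k)$ into exactly $k$ distinct odd parts such that $\pi_i - \pi_{i+1} \le 2m$ for all $1 \le i \le k$, with the convention $\pi_{k+1} = 0$ (so in particular the smallest part is at most $2m$). $T_k$ denotes the partition $(2k-1, 2k-3, \ldots, 3, 1)$. $H_{k,m}$ is the set of partitions (including the empty partition) each of whose parts is at most $k$ and in which the multiplicity of each part that occurs is an even number less than $2m$. *)

(* Defs.v *)
From mathcomp Require Import all_boot.

Set Implicit Arguments.
Unset Strict Implicit.
Unset Printing Implicit Defensive.

(* Partitions are written in weakly decreasing order, as lists of positive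
   integers; the empty partition is [::]. *)
Definition is_partition (p : seq nat) : bool := sorted geq p && (0 \notin p).

(* The part pi_(i+1) is [nth 0 p i], so the default value 0 realizes the
   convention pi_(k+1) = 0.  The truncated subtraction is the true difference,
   because p is weakly decreasing. *)
Definition B (k m : nat) : pred (seq nat) := fun p =>
  [&& is_partition p, size p == k, uniq p, all odd p
    & [forall i : 'I_k, nth 0 p i - nth 0 p i.+1 <= 2 * m]].

Definition T (k : nat) : seq nat := [seq 2 * (k - i) - 1 | i <- iota 0 k].

Definition H (k m : nat) : pred (seq nat) := fun p =>
  [&& is_partition p, all (fun x => x <= k) p
    & all (fun x => ~~ odd (count_mem x p) && (count_mem x p < 2 * m)) p].

(* Main.v *)
Require Import Defs.
From mathcomp Require Import all_boot.
From mathcomp Require Import zify.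

Set Implicit Arguments.
Unset Strict Implicit.
Unset Printing Implicit Defensive.

(** Subtracting T_k from pi in B_{k,m} leaves a weakly decreasing sequence of
    even numbers with successive differences in {0, 2, ..., 2m-2}; its conjugate,
    in which i.+1 occurs as often as the i-th difference, lies in H_{k,m}.
    Conversely, pi is recovered by adding to the i-th part of T_k the number of
    parts of the conjugate that exceed i. *)

Lemma nth_T k i : nth 0 (T k) i = 2 * (k - i) - 1.
Proof.
have [lt_ik|le_ki] := ltnP i k; first by rewrite (nth_map 0) ?size_iota ?nth_iota.
by rewrite nth_default ?size_map ?size_iota //; lia.
Qed.

Fixpoint partition_of_mults (d : nat -> nat) (k : nat) : seq nat :=
  if k is j.+1 then nseq (d j) j.+1 ++ partition_of_mults d j else [::].

Lemma partition_of_mults_bounds d k x :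
  x \in partition_of_mults d k -> 0 < x <= k.
Proof.
elim: k => //= k IHk; rewrite mem_cat mem_nseq => /orP[/andP[_ /eqP->]|/IHk]; lia.
Qed.

Lemma is_partition_of_mults d k : is_partition (partition_of_mults d k).
Proof.
apply/andP; split; last by apply/negP => /partition_of_mults_bounds.
elim: k => //= k IHk; elim: (d k) => //= n IHn.
rewrite path_min_sorted //; apply/allP => x.
rewrite mem_cat mem_nseq => /orP[/andP[_ /eqP->]|/partition_of_mults_bounds] /=; lia.
Qed.

Lemma count_partition_of_mults d k i :
  i < k -> count_mem i.+1 (partition_of_mults d k) = d i.
Proof.
elim: k => //= k IHk; rewrite ltnS count_cat count_nseq /= eqSS leq_eqVlt.
case: eqP => [->|/eqP ne_ik] /=; last by rewrite eq_sym (negPf ne_ik); apply: IHk.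
rewrite eqxx mul1n => _; rewrite (count_memPn _) ?addn0 //.
by apply/negP => /partition_of_mults_bounds; rewrite ltnn andbF.
Qed.

(** [count (ltn i) h] is the part of index [i] in the conjugate of [h], so multiplicities in [h] are
    the successive differences of its conjugate. *)
Lemma count_gtS i (h : seq nat) :
  count (ltn i) h = count_mem i.+1 h + count (ltn i.+1) h.
Proof. by elim: h => //= x h ->; lia. Qed.

Lemma count_gt_max k (h : seq nat) : all (fun x => x <= k) h -> count (ltn k) h = 0.
Proof. by elim: h => //= x h IHh /andP[le_xk /IHh ->]; lia. Qed.

Lemma partition_of_count_mem k h :
    is_partition h -> all (fun x => x <= k) h ->
  partition_of_mults (fun i => count_mem i.+1 h) k = h.
Proof.
move=> /andP[sorted_h h0] /allP le_hk.
have /andP[sorted_p p0] := is_partition_of_mults (fun i => count_mem i.+1 h) k.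
apply: (sorted_eq (leT := geq)) => //.
- by move=> y x z /= le_yx le_zy; apply: leq_trans le_yx.
- by move=> x y /= le_xy; apply/anti_leq; rewrite andbC.
(* The permutation reduces to equal multiplicities: 0 and the values above [k] occur in neither
   list, and 1 to [k] agree by construction. *)
apply/allP => -[|i] _ /=; first by rewrite !(count_memPn _).
have [lt_ik|le_ki] := ltnP i k; first by rewrite count_partition_of_mults.
rewrite !(count_memPn _) //; apply/negP; first by move/le_hk; lia.
by move/partition_of_mults_bounds; lia.
Qed.

(** Weakly decreasing and distinct amount to strictly decreasing, and oddness excludes the part 0.
    At the last index the default value 0 makes the strict inequality say that the smallest part is
    positive. *)
Lemma BP k m p :
  reflect (size p = k /\ forall i, i < k ->
             odd (nth 0 p i) && (nth 0 p i.+1 < nth 0 p i <= nth 0 p i.+1 + 2 * m))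
          (B k m p).
Proof.
apply: (iffP idP).
  case/and5P => /andP[sorted_p _] /eqP size_p uniq_p odd_p /forallP dif_p.
  split=> // i lt_ik; have odd_i : odd (nth 0 p i).
    by apply: (allP odd_p); rewrite mem_nth ?size_p.
  have := dif_p (Ordinal lt_ik); rewrite /= odd_i.
  have sorted_gt : sorted gtn p by rewrite gtn_sorted_uniq_geq uniq_p.
  have [lt_i1k|le_ki1] := ltnP i.+1 k.
    have /(sortedP 0)/(_ i) := sorted_gt; rewrite size_p /= => /(_ lt_i1k); lia.
  by rewrite (nth_default 0 (n := i.+1)) ?size_p //; lia.
move=> [size_p p_i].
have odd_p : all odd p by apply/(all_nthP 0) => i; rewrite size_p => /p_i/andP[].
have : sorted gtn p.
  by apply/(sortedP 0) => i; rewrite size_p => /ltnW/p_i/and3P[].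
rewrite gtn_sorted_uniq_geq => /andP[uniq_p sorted_p].
rewrite /B /is_partition sorted_p uniq_p odd_p size_p eqxx /=.
apply/andP; split; first by apply/negP => /(allP odd_p).
by apply/forallP => i; have /and3P[] := p_i i (ltn_ord i); lia.
Qed.

(** The difference at [i] of the sequence [p] minus [T k], arranged as a difference of gaps so that
    for [p] in [B k m] and [i < k] no subtraction truncates. *)
Definition excess (k : nat) (p : seq nat) (i : nat) : nat :=
  (nth 0 p i - nth 0 p i.+1) - (nth 0 (T k) i - nth 0 (T k) i.+1).

Definition H_of_B (k : nat) (p : seq nat) : seq nat :=
  partition_of_mults (excess k p) k.

Definition B_of_H (k : nat) (h : seq nat) : seq nat :=
  [seq nth 0 (T k) i + count (ltn i) h | i <- iota 0 k].

(** The case [i = k] is included so that [i.+1] is allowed for every [i < k]; there both sides are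
    0, since no part of [h] exceeds [k]. *)
Lemma nth_B_of_H k h i :
    all (fun x => x <= k) h -> i <= k ->
  nth 0 (B_of_H k h) i = nth 0 (T k) i + count (ltn i) h.
Proof.
move=> le_hk; rewrite leq_eqVlt => /orP[/eqP->|lt_ik].
  by rewrite nth_default ?size_map ?size_iota // nth_T count_gt_max //; lia.
by rewrite (nth_map 0) ?size_iota ?nth_iota.
Qed.

Lemma excess_B_of_H k h i :
    all (fun x => x <= k) h -> i < k ->
  excess k (B_of_H k h) i = count_mem i.+1 h.
Proof.
move=> le_hk lt_ik; rewrite /excess !nth_B_of_H ?(ltnW lt_ik) // (count_gtS i) !nth_T; lia.
Qed.

Lemma eq_partition_of_mults d d' k :
    (forall i, i < k -> d i = d' i) ->
  partition_of_mults d k = partition_of_mults d' k.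
Proof.
by elim: k => //= k IHk eq_d; rewrite eq_d // IHk // => i lt_ik; apply/eq_d/ltnW.
Qed.

(** Gaps of [T k] are 2, except the last, which is 1. Inner gaps of [p] are even, from 2 to [2 * m];
    the last is odd, from 1 to [2 * m - 1]. Either way the excess is even and at most
    [2 * m - 2]. *)
Lemma B_nth_excess k m p i : B k m p -> i < k ->
  nth 0 p i + nth 0 (T k) i.+1 = nth 0 p i.+1 + nth 0 (T k) i + excess k p i
  /\ ~~ odd (excess k p i) && (excess k p i < 2 * m).
Proof.
case/BP => size_p p_i lt_ik; rewrite /excess !nth_T.
have /and3P[odd_i lt_p le_p] := p_i i lt_ik.
have [lt_i1k|le_ki1] := ltnP i.+1 k; last by rewrite [nth 0 p i.+1]nth_default in lt_p le_p *; lia.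
by have /and3P[odd_i1 _ _] := p_i _ lt_i1k; lia.
Qed.

Lemma H_H_of_B k m p : B k m p -> H k m (H_of_B k p).
Proof.
move=> Bp; rewrite /H is_partition_of_mults /=; apply/andP; split; apply/allP => x.
  by case/partition_of_mults_bounds/andP.
case/partition_of_mults_bounds/andP; case: x => // i _ lt_ik.
by rewrite count_partition_of_mults //; case: (B_nth_excess Bp lt_ik).
Qed.

Lemma B_B_of_H k m h : 0 < m -> H k m h -> B k m (B_of_H k h).
Proof.
move=> m_gt0 /and3P[_ le_hk /allP mult_h].
(* The bound extends to values absent from [h], whose multiplicity is 0, because [0 < m]. *)
have mult_i i : ~~ odd (count_mem i h) && (count_mem i h < 2 * m).
  by have [/mult_h//|/count_memPn->] := boolP (i \in h); rewrite muln_gt0.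
(* Downward induction from [k], with [n] the distance to [k]: conjugate parts are sums of even
   multiplicities, so adding them to [T k] keeps the parts odd. *)
have even_gt n i : i + n = k -> ~~ odd (count (ltn i) h).
  elim: n i => [|n IHn] i def_k; first by rewrite -def_k addn0 in le_hk; rewrite count_gt_max.
  rewrite count_gtS oddD (negPf (IHn _ _)) ?addSnnS //.
  by case/andP: (mult_i i.+1) => /negPf->.
apply/BP; split=> [|i lt_ik]; first by rewrite size_map size_iota.
have := even_gt (k - i) i (subnKC (ltnW lt_ik)).
rewrite !nth_B_of_H ?(ltnW lt_ik) // !nth_T (count_gtS i).
have := mult_i i.+1; lia.
Qed.

Lemma H_of_BK k m p : B k m p -> B_of_H k (H_of_B k p) = p.
Proof.
move=> Bp; have [size_p _] := BP k m p Bp; have /and3P[_ le_hk _] := H_H_of_B Bp.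
(* Both sides vanish at index [k] and have the same gaps below it, so equality propagates
   downward. *)
have nth_p n i : i + n = k -> nth 0 p i = nth 0 (T k) i + count (ltn i) (H_of_B k p).
  elim: n i => [|n IHn] i def_k.
    rewrite addn0 in def_k; rewrite def_k count_gt_max // nth_T nth_default ?size_p //; lia.
  have lt_ik : i < k by lia.
  have [] := B_nth_excess Bp lt_ik; rewrite (IHn i.+1) ?addSnnS //.
  rewrite (count_gtS i) count_partition_of_mults //; lia.
apply: (eq_from_nth (x0 := 0)) => [|i]; rewrite size_map size_iota ?size_p // => lt_ik.
by rewrite nth_B_of_H ?(ltnW lt_ik) // (nth_p (k - i) i (subnKC (ltnW lt_ik))).
Qed.

Lemma B_of_HK k m h : H k m h -> H_of_B k (B_of_H k h) = h.
Proof.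
case/and3P => part_h le_hk _; rewrite -[RHS](partition_of_count_mem part_h le_hk).
by apply: eq_partition_of_mults => i; apply: excess_B_of_H.
Qed.

Theorem theorem8p1 (k m : nat) (hk : 1 <= k) (hm : 1 <= m) :
  exists f : {p : seq nat | B k m p} ->
             {p : seq nat | p == T k} * {p : seq nat | H k m p},
    bijective f.
Proof.
exists (fun p => (exist (fun t => t == T k) (T k) (eqxx _), exist (H k m) _ (H_H_of_B (valP p)))).
exists (fun th => exist (B k m) _ (B_B_of_H hm (valP th.2))) => [p|[t h]].
  by apply: val_inj => /=; apply: H_of_BK (valP p).
congr pair; apply: val_inj => /=; first by rewrite (eqP (valP t)).
exact: B_of_HK (valP h).
Qed.
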